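(* There is an absolute constant $\eta>0$ such that for all sufficiently large integers $N$, every admissible set $A\subseteq\{1,\dots,N\}$ satisfies $|A|<(1-\eta)N$. Moreover, one may take $\eta=e^{-5000}$ for $N\ge e^{200000}$; that is, for every integer $N\ge e^{200000}$, every admissible $A\subseteq\{1,\dots,N\}$ satisfies $|A|<(1-e^{-5000})N$.
   Context: A set $A$ of positive integers is called admissible if for all finite subsets $S,T\subseteq A$ with $\prod_{s\in S}s=\prod_{t\in T}t$ one has $|S|=|T|$ (the empty product is $1$, so in particular $1\notin A$). *)

(* Defs.v *)
From HB Require Import structures.
From mathcomp Require Import all_boot all_order all_algebra.
From mathcomp Require Import finmap.
From mathcomp Require Import all_classical.

Set Implicit Arguments.
Unset Strict Implicit.
Unset Printing Implicit Defensive.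

Local Open Scope classical_set_scope.
Local Open Scope nat_scope.

Definition admissible (A : set nat) : Prop :=
  (forall a, A a -> 0 < a) /\
  forall S T : {fset nat},
    [set` S] `<=` A -> [set` T] `<=` A ->
    \prod_(s <- S) s = \prod_(t <- T) t -> #|` S| = #|` T|.

(* Main.v *)
(** Write r ~ 1 when r is robustly a quotient of two products of equally many
    distinct elements of A. If a ~ 1 for some a in A, then a times the denominator
    equals the numerator, and A is not admissible. If u ~ 1 and um, qm lie in A for
    many m, then q ~ 1, because q = u (qm)/(um). Let B be the complement of A in
    [1, N], assumed to have tiny density. Small primes are ~ 1 (take u = 1). Let E(y)
    be the sum of 1/q over the primes q < y that are not ~ 1; it stays below 1/256
    for y up to almost N. Indeed, at a first crossing, a second-moment argument shows
    that most such q have few multiples in B. For these q, almost all multiples of any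
    u <= q with u ~ 1 of the same size as q must be in B. Take u = p1 p2 with
    p1, p2 ~ 1: since E is still small below the crossing and Chebyshev's bounds hold
    in each block [16^i, 16^(i+1)), such u are so plentiful that a second-moment
    argument over their multiples forces B to have positive density. Finally, every
    element of A has a prime factor that is not ~ 1, so
    |A| <= N (1/256 + the contribution of primes close to N) < N/2. *)

Require Import Defs.
From HB Require Import structures.
From mathcomp Require Import all_boot all_order all_algebra.
From mathcomp Require Import finmap.
From mathcomp Require Import all_classical all_reals all_analysis.
From mathcomp Require Import zify ring lra.

Set Implicit Arguments.
Unset Strict Implicit.
Unset Printing Implicit Defensive.

Import Order.TTheory GRing.Theory Num.Theory.

(** * Chebyshev bounds on the blocks [16^i, 16^(i+1)) *)

Lemma central_bin_rec n :
  n.+1 * 'C(n.+1.*2, n.+1) = 2 * (n.*2.+1 * 'C(n.*2, n)).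
Proof.
have h1 : n.*2.+1 * 'C(n.*2, n) = n.+1 * 'C(n.*2.+1, n.+1) := (mul_bin_diag n.*2.+1 n).
have h2 : n.*2.+2 * 'C(n.*2.+1, n) = n.+1 * 'C(n.*2.+2, n.+1).
  exact: (mul_bin_diag n.*2.+2 n).
have h3 : 'C(n.*2.+1, n) = 'C(n.*2.+1, n.+1).
  by rewrite -[in LHS]bin_sub; [congr binomial; lia|lia].
rewrite doubleS -h2 h3; nia.
Qed.

Lemma central_bin_ge n : 0 < n -> 4 ^ n <= n.*2 * 'C(n.*2, n).
Proof.
elim: n => // -[_ _ //|n IHn _].
have := IHn isT; set c := 'C(_, _) => h.
have := central_bin_rec n.+1; rewrite -/c.
rewrite expnS; set c' := 'C(_, _); nia.
Qed.

Lemma central_bin_le n : 'C(n.*2, n) <= 4 ^ n.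
Proof.
have -> : 4 ^ n = 2 ^ n.*2 by rewrite -mul2n expnM.
have := expnDn 1 1 n.*2; rewrite addn1 => ->.
have hn : n < n.*2.+1 by lia.
by rewrite (bigD1 (Ordinal hn)) //= !exp1n !muln1 leq_addr.
Qed.

(** By Legendre's formula each [k] contributes the floor of 2n / p^k minus twice the floor of n /
    p^k. This is 0 or 1, and it is 0 once p^k exceeds 2n. *)
Lemma logn_central_bin p n : prime p -> 0 < n ->
  logn p 'C(n.*2, n) <= trunc_log p n.*2.
Proof.
move=> pp n0; have p1 := prime_gt1 pp.
set t := trunc_log _ _; set v := logn _ _.
have hn : n <= n.*2 by lia.
have hf : v + (logn p n`!).*2 = logn p (n.*2)`!.
  rewrite -(bin_fact hn) !lognM ?muln_gt0 ?fact_gt0 ?bin_gt0 //.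
  by rewrite -/v (_ : n.*2 - n = n) ?addnn //; lia.
have hw : logn p n`! = \sum_(1 <= k < n.*2.+1) n %/ p ^ k.
  rewrite logn_fact // [RHS](@big_cat_nat _ _ _ n.+1) //=.
  rewrite [X in _ + X]big_nat_cond [X in _ + X]big1 ?addn0 // => k /andP[/andP[hk _] _].
  by apply: divn_small; apply: leq_trans (ltn_expl k p1); lia.
have hs : \sum_(1 <= k < n.*2.+1) (k <= t) <= t.
  rewrite -(big_mkcond (fun k => k <= t) (fun=> 1)) sum1_count -size_filter.
  rewrite -[X in _ <= X](size_iota 1); apply: uniq_leq_size.
    by rewrite filter_uniq // iota_uniq.
  by move=> k; rewrite mem_filter !mem_index_iota mem_iota; lia.
suff : v + (logn p n`!).*2 <= t + (logn p n`!).*2 by lia.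
rewrite {1}hf logn_fact // hw -[X in _ <= _ + X]mul2n big_distrr /=.
apply: leq_trans (leq_add hs (leqnn _)).
rewrite -big_split /=; apply: leq_sum => k _.
have pk : 0 < p ^ k by rewrite expn_gt0 prime_gt0.
case: (leqP k t) => hk.
  have h1 := divn_eq n.*2 (p ^ k); have h2 := divn_eq n (p ^ k).
  have := ltn_pmod n.*2 pk; have := ltn_pmod n pk.
  move: h1 h2 pk; move: (n.*2 %/ _) (n %/ _) (n.*2 %% _) (n %% _).
  by move: (p ^ k) => q a b c d; nia.
rewrite divn_small //; apply: leq_trans (trunc_log_ltn _ p1) _.
by rewrite leq_exp2l.
Qed.

Lemma dvdn_prod_primes (s : seq nat) m : uniq s -> all prime s ->
  {in s, forall p, p %| m} -> \prod_(p <- s) p %| m.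
Proof.
elim: s => [|p s IHs] /= => [_ _ _|/andP[ps us] /andP[pp aps] h].
  by rewrite big_nil dvd1n.
rewrite big_cons Gauss_dvd; last first.
  rewrite coprime_sym big_seq; elim/big_ind: _ => [|x y|q qs].
  - by rewrite coprime1n.
  - by rewrite coprimeMl => -> ->.
  - rewrite prime_coprime ?dvdn_prime2 ?(allP aps q qs) //.
    by apply: contraNneq ps => <-.
rewrite (h p (mem_head _ _)) IHs // => q qs.
by apply: h; rewrite inE qs orbT.
Qed.

(** Every prime in (n, 2n] divides (2n)! but not n!, hence divides the central binomial
    coefficient. *)
Lemma prod_primes_le_central_bin n :
  \prod_(n.+1 <= p < n.*2.+1 | prime p) p <= 4 ^ n.
Proof.
apply: leq_trans (central_bin_le n).
rewrite dvdn_leq ?bin_gt0 //; first lia.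
rewrite -big_filter; apply: dvdn_prod_primes.
- by rewrite filter_uniq // iota_uniq.
- exact: filter_all.
move=> p; rewrite mem_filter mem_index_iota => /andP[pp /andP[h1 h2]].
have hn : n <= n.*2 by lia.
have : p %| (n.*2)`! by rewrite dvdn_fact // prime_gt0 //; lia.
rewrite -(bin_fact hn) !Euclid_dvdM //.
rewrite (_ : n.*2 - n = n); last by lia.
suff /negbTE -> : ~~ (p %| n`!) by rewrite !orbF.
elim: n h1 {hn h2} => [|n IHn] h; first by rewrite fact0 dvdn1 neq_ltn prime_gt1 ?orbT.
by rewrite factS Euclid_dvdM // negb_or gtnNdvd //= IHn //; lia.
Qed.

Lemma primorial_le k : \prod_(0 <= p < (2 ^ k).+1 | prime p) p <= 4 ^ (2 ^ k).
Proof.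
elim: k => [|k IHk]; first by rewrite unlock.
rewrite (@big_cat_nat _ _ _ (2 ^ k).+1) //=; last by rewrite ltnS leq_exp2l.
have -> : 4 ^ (2 ^ k.+1) = 4 ^ (2 ^ k) * 4 ^ (2 ^ k).
  by rewrite -expnD addnn expnS mul2n.
by rewrite leq_mul // expnS mul2n; exact: prod_primes_le_central_bin.
Qed.

(** With base 16 the block ends are powers of two and have integer square roots [4 ^ i]; both facts
    serve the Chebyshev bounds. By default [blk 0] is 0. *)
Definition blk (n : nat) := trunc_log 16 n.

Lemma blk_lt n : n < 16 ^ (blk n).+1. Proof. exact: trunc_log_ltn. Qed.

Lemma blk_ge n : 0 < n -> 16 ^ blk n <= n. Proof. exact: trunc_logP. Qed.

Lemma expn16 i : 16 ^ i = 2 ^ (4 * i). Proof. by rewrite expnM. Qed.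

Lemma primorial_primes k (s : seq nat) : uniq s -> all prime s ->
  {in s, forall p, p <= 2 ^ k} -> \prod_(p <- s) p <= 2 ^ (2 * 2 ^ k).
Proof.
move=> us ps hs; rewrite [X in _ <= X]expnM; apply: leq_trans (primorial_le k).
rewrite dvdn_leq //.
  by rewrite prodn_cond_gt0 // => p /prime_gt0.
apply: dvdn_prod_primes => // p sp; have pp := allP ps _ sp.
rewrite big_mkcond (big_rem p) /=; last by rewrite mem_index_iota; have := hs p sp; lia.
by rewrite pp dvdn_mulr.
Qed.

Lemma prodn_const_seq (I : Type) (s : seq I) n : \prod_(i <- s) n = n ^ size s.
Proof. by rewrite big_const_seq count_predT iter_muln_1. Qed.

(** The primes of the block are at least 16^i each, and their product is at most 2^(2 * 16^(i+1)).
    Comparing exponents of 2 gives 4 * i * count <= 32 * 16^i. *)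
Lemma prime_block_le X i :
  i * count (fun p => prime p && (blk p == i)) (iota 0 X) <= 8 * 16 ^ i.
Proof.
rewrite -size_filter; set s := seq.filter _ _.
have us : uniq s by rewrite filter_uniq // iota_uniq.
have hs p : p \in s -> prime p /\ blk p = i.
  by rewrite mem_filter => /andP[/andP[pp /eqP ?] _].
have h1 : (16 ^ i) ^ size s <= \prod_(p <- s) p.
  rewrite -prodn_const_seq; rewrite !big_seq; apply: leq_prod => p /hs [pp <-].
  by rewrite blk_ge // prime_gt0.
have h2 : \prod_(p <- s) p <= 2 ^ (2 * 2 ^ (4 * i.+1)).
  apply: primorial_primes => //; first by apply/allP => p /hs [].
  by move=> p /hs [_ <-]; rewrite -expn16 ltnW // blk_lt.
have := leq_trans h1 h2; rewrite expn16 -expnM leq_exp2l // -!expn16 expnS; nia.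
Qed.

(** The binomial coefficient C(2n, n) with 2n = 16^(i+1) is at least 4^n / (2n). Its primes below
    16^i supply only a small part of this, so the primes of the block must supply the rest. *)
Lemma prime_block_ge X i : 3 <= i -> 16 ^ i.+1 <= X ->
  2 * 16 ^ i <= i * count (fun p => prime p && (blk p == i)) (iota 0 X).
Proof.
move=> i3 hX; rewrite -size_filter; set s := seq.filter _ _.
pose n := 2 ^ (4 * i + 3).
have n2 : n.*2 = 16 ^ i.+1 by rewrite -mul2n /n -expnS expn16; congr (_ ^ _); lia.
have n0 : 0 < n by rewrite expn_gt0.
set c := 'C(n.*2, n); have c0 : 0 < c by rewrite bin_gt0; lia.
have hC := central_bin_ge n0; rewrite -/c in hC.
have pc p : p \in primes c -> [/\ prime p, p ^ logn p c <= n.*2 & p <= n.*2].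
  move=> pC; have pp : prime p by move: pC; rewrite mem_primes => /andP[].
  have h := logn_central_bin pp n0; rewrite -/c in h.
  have h' : p ^ logn p c <= n.*2.
    apply: leq_trans (trunc_logP (prime_gt1 pp) _); last lia.
    by rewrite leq_exp2l // prime_gt1.
  split=> //; apply: leq_trans h'; rewrite -{1}[p]expn1 leq_exp2l ?prime_gt1 //.
  by rewrite logn_gt0.
(* A prime above [4 ^ i.+1], the square root of 2n, divides [c] at most once, so below 16^i the
   factor [f1] covers it. The few primes up to that root get a full 2n from [f2], and those from
   16^i on get 2n from [f3]. *)
pose f1 p := if p < 16 ^ i then p else 1.
pose f2 p := if p <= 4 ^ i.+1 then n.*2 else 1.
pose f3 p := if 16 ^ i <= p then n.*2 else 1.
have hc : c <= \prod_(p <- primes c) (f1 p * f2 p * f3 p).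
  rewrite [X in X <= _]prod_prime_decomp // prime_decompE big_map /= !big_seq.
  apply: leq_prod => p /pc [pp h1 h2]; rewrite /f1 /f2 /f3.
  have p0 := prime_gt0 pp.
  case: (ltnP p) => h3.
    rewrite muln1; case: (leqP p) => h4; first by apply: leq_trans h1 _; nia.
    rewrite muln1 -{3}[p]expn1 leq_exp2l ?prime_gt1 //.
    have h5 := logn_central_bin pp n0; apply: leq_trans h5 _.
    rewrite -ltnS -(@ltn_exp2l p) ?prime_gt1 //.
    apply: leq_ltn_trans (trunc_logP (prime_gt1 pp) _) _; first lia.
    by rewrite n2 (_ : 16 = 4 ^ 2) // -expnM mulnC expnM ltn_exp2r.
  by rewrite mul1n; apply: leq_trans h1 _; case: ifP; nia.
rewrite !big_split /= in hc.
have h1 : \prod_(p <- primes c) f1 p <= 2 ^ (2 * 16 ^ i).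
  rewrite -big_mkcond -big_filter expn16; apply: primorial_primes.
  - by rewrite filter_uniq // primes_uniq.
  - by apply/allP => p; rewrite mem_filter => /andP[_ /pc []].
  - by move=> p; rewrite mem_filter -expn16 => /andP[/ltnW].
have h2 : \prod_(p <- primes c) f2 p <= 2 ^ (4 * i.+1 * 4 ^ i.+1).
  rewrite -big_mkcond -big_filter prodn_const_seq n2 expn16 -expnM leq_exp2l //.
  rewrite leq_mul2l /= -[X in _ <= X](size_iota 1); apply: uniq_leq_size.
    by rewrite filter_uniq // primes_uniq.
  move=> p; rewrite mem_filter mem_iota => /andP[h /pc [/prime_gt0 ? _ _]]; lia.
have h3 : \prod_(p <- primes c) f3 p <= 2 ^ (4 * i.+1 * size s).
  rewrite -big_mkcond -big_filter prodn_const_seq n2 expn16 -expnM leq_exp2l //.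
  rewrite leq_mul2l /=; apply: uniq_leq_size.
    by rewrite filter_uniq // primes_uniq.
  move=> p; rewrite mem_filter => /andP[h /pc [pp _ h']].
  have pn : p < 16 ^ i.+1.
    rewrite ltn_neqAle -n2 h' andbT; apply/eqP => e.
    have : 2 %| p by rewrite e -mul2n dvdn_mulr.
    rewrite dvdn_prime2 // => /eqP e2; move: e; rewrite -e2 n2 expnS.
    by move=> e; have q0 : 0 < 16 ^ i; [rewrite expn_gt0|lia].
  rewrite mem_filter pp mem_iota /= (leq_trans pn hX) andbT.
  by apply/eqP/trunc_log_eq => //; rewrite h.
have := leq_trans hC (leq_mul (leqnn _) (leq_trans hc (leq_mul (leq_mul h1 h2) h3))).
rewrite (_ : 4 ^ n = 2 ^ n.*2); last by rewrite -mul2n expnM.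
rewrite n2 [X in _ <= X * _]expn16 -!expnD leq_exp2l //.
(* With r = 4^i and P = [size s] the exponents read 16r^2 <= 4(i+1) + 2r^2 + 16(i+1)r + 4(i+1)P. The
   bound [hr] absorbs the lower-order terms and leaves 3r^2 <= (i+1)P; since i >= 3, i/(i+1) >= 3/4
   and 2r^2 <= iP follows. *)
have hr : 10 * i.+1 <= 4 ^ i.
  elim: i i3 {n n2 n0 c c0 hC pc f1 f2 f3 hc h1 h2 h3 s hX} => // i IH.
  rewrite leq_eqVlt => /orP[/eqP <- //|/IH]; rewrite [4 ^ i.+1]expnS; lia.
have -> : 16 ^ i.+1 = 16 * (4 ^ i * 4 ^ i) by rewrite expnS -expnMn.
have -> : 16 ^ i = 4 ^ i * 4 ^ i by rewrite -expnMn.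
rewrite [4 ^ i.+1]expnS; move: (4 ^ i) (size s) hr => r P hr hh.
have h4 : 4 * i.+1 * (4 * r + 1) <= 2 * (r * r) by nia.
have h5 : 3 * (r * r) <= i.+1 * P by nia.
nia.
Qed.

(** * Integers that are robustly balanced quotients *)

(* [F] is an arbitrary forbidden set: avoiding it is what keeps the factors distinct
   when representations are multiplied. *)
Definition balanced (A : pred nat) (K r L : nat) : Prop :=
  forall F : seq nat, size F + L <= K ->
  exists s t : seq nat, [/\ uniq s, uniq t, all (fun x => A x && (x \notin F)) (s ++ t),
    size s = size t /\ size s + size t <= L & r * \prod_(x <- t) x = \prod_(x <- s) x].

Lemma balanced1 A K : balanced A K 1 0.
Proof. by move=> F _; exists [::], [::]; rewrite !big_nil. Qed.

Lemma balancedW A K r L L' : L <= L' -> balanced A K r L -> balanced A K r L'.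
Proof.
move=> hL h F hF; have [|s [t [us ut hA [e1 e2] e]]] := h F; first by lia.
by exists s, t; split=> //; split=> //; lia.
Qed.

(** The second representation is asked to avoid the at most [L1] entries of the first one as well,
    so the concatenated lists stay free of repetitions. The budget [K] pays for these extra
    forbidden values. *)
Lemma balancedM A K r1 r2 L1 L2 :
  balanced A K r1 L1 -> balanced A K r2 L2 -> balanced A K (r1 * r2) (L1 + L2).
Proof.
move=> h1 h2 F hF.
have [|s1 [t1 [us1 ut1 hA1 [e1 l1] p1]]] := h1 F; first by lia.
have [|s2 [t2 [us2 ut2 hA2 [e2 l2] p2]]] := h2 (F ++ s1 ++ t1).
  by rewrite !size_cat; lia.
have d x : x \in s2 ++ t2 -> [/\ A x, x \notin F, x \notin s1 & x \notin t1].
  move=> /(allP hA2) /andP[-> ]; rewrite !mem_cat !negb_or => /and3P[? ? ?]; by split.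
exists (s1 ++ s2), (t1 ++ t2); split.
- rewrite cat_uniq us1 us2 andbT; apply/hasPn => x hx.
  by have [|_ _ ? _] := d x; rewrite ?mem_cat ?hx.
- rewrite cat_uniq ut1 ut2 andbT; apply/hasPn => x hx.
  by have [|_ _ _ ?] := d x; rewrite ?mem_cat ?hx ?orbT.
- apply/allP => x; rewrite !mem_cat.
  have hx1 : x \in s1 ++ t1 -> A x && (x \notin F) by move/(allP hA1).
  have hx2 : x \in s2 ++ t2 -> A x && (x \notin F) by move/d => [-> ->].
  by rewrite !mem_cat in hx1 hx2; case/orP => /orP[] h;
    [apply: hx1|apply: hx2|apply: hx1|apply: hx2]; rewrite h ?orbT.
- by rewrite !size_cat; split; lia.
- by rewrite !big_cat /= -p1 -p2; ring.
Qed.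

Lemma count_mem_mul_le (F : seq nat) (d n : nat) : 0 < d ->
  count (fun m => d * m \in F) (iota 1 n) <= size F.
Proof.
move=> d0; rewrite -(count_map (muln d) (mem F)) -size_filter.
apply: uniq_leq_size; last by move=> x; rewrite mem_filter => /andP[].
rewrite filter_uniq // map_inj_uniq ?iota_uniq // => x y /eqP.
by rewrite eqn_pmul2l // => /eqP.
Qed.

(** This is q = u (qm) / (um). The set [F] spoils at most [K] values of [m] through [q * m] and at
    most [K] through [u * m], so more than [2 * K] candidates leave a usable one. *)
Lemma balanced_swap A K q u L n : 0 < q -> 0 < u ->
  2 * K < count (fun m => A (q * m) && A (u * m)) (iota 1 n) ->
  balanced A K u L -> balanced A K q (L + 2).
Proof.
move=> q0 u0 hn hu F hF.
have [m /andP[hq1 hq2] /andP[hu1 hu2]] :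
    exists2 m, A (q * m) && (q * m \notin F) & A (u * m) && (u * m \notin F).
  pose P m := [&& A (q * m) && (q * m \notin F) & A (u * m) && (u * m \notin F)].
  suff /hasP[m _ /andP[? ?]] : has P (iota 1 n) by exists m.
  rewrite has_count; set c := count P _.
  have : count (fun m => A (q * m) && A (u * m)) (iota 1 n) <= c +
      count (fun m => q * m \in F) (iota 1 n) + count (fun m => u * m \in F) (iota 1 n).
    rewrite /c; elim: (iota 1 n) => //= x s IH; rewrite [P x]/P.
    by case: (A (q * x)); case: (A (u * x)); case: (q * x \in F);
      case: (u * x \in F); rewrite /=; lia.
  have := count_mem_mul_le F n q0; have := count_mem_mul_le F n u0; lia.
(* Forbidding the two new entries costs 2, exactly the increase from [L] to [L + 2]. *)
have [|s [t [us ut hA [e1 l1] pe]]] := hu [:: q * m, u * m & F]; first by rewrite /=; lia.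
have d x : x \in s ++ t -> [/\ A x, x \notin F, x != q * m & x != u * m].
  by move=> /(allP hA) /andP[->]; rewrite !inE !negb_or => /and3P[].
exists (q * m :: s), (u * m :: t); split.
- rewrite /= us andbT; apply/negP => h.
  by have [|_ _] := d (q * m); rewrite ?mem_cat ?h ?eqxx.
- rewrite /= ut andbT; apply/negP => h.
  by have [|_ _ _] := d (u * m); rewrite ?mem_cat ?h ?orbT ?eqxx.
- apply/allP => x; rewrite mem_cat !inE -orbA => /or4P[/eqP ->|h|/eqP ->|h].
  + by rewrite hq1.
  + by have [|-> ->] := d x; rewrite ?mem_cat ?h.
  + by rewrite hu1.
  + by have [|-> ->] := d x; rewrite ?mem_cat ?h ?orbT.
- by rewrite /=; split; lia.
- by rewrite !big_cons -pe; ring.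
Qed.

(** Induction peeling off the least prime factor: every prime factor is at least 2, so there are at
    most [trunc_log 2 n] of them with multiplicity. *)
Lemma balanced_of_primes A K l n : 0 < n ->
  (forall p, prime p -> p %| n -> balanced A K p l) ->
  balanced A K n (l * trunc_log 2 n).
Proof.
have [k] := ubnP n; elim: k n => // k IHk n nk n0 hp.
have [n1|n1] := leqP n 1.
  have -> : n = 1 by lia.
  by rewrite trunc_log1 muln0; exact: balanced1.
pose p := pdiv n; have pp : prime p by rewrite pdiv_prime.
have dp : p %| n by exact: pdiv_dvd.
have e : n = p * (n %/ p) by rewrite mulnC divnK.
have m0 : 0 < n %/ p by rewrite divn_gt0 ?prime_gt0 // dvdn_leq.
have p1 := prime_gt1 pp.
have hm := IHk (n %/ p) _ m0 _.
rewrite [X in balanced _ _ X _]e.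
apply: (@balancedW _ _ _ (l + l * trunc_log 2 (n %/ p))).
  rewrite -mulnS leq_mul2l; apply/orP; right; apply: trunc_log_max => //.
  rewrite expnS [X in _ <= X]e leq_mul // trunc_logP //.
apply: balancedM; first exact: hp.
apply: hm; first by apply: leq_trans (ltn_Pdiv p1 n0) _; lia.
by move=> r pr dr; apply: hp => //; rewrite e dvdn_mull.
Qed.

Lemma count_avoiding_multiples (A : pred nat) (N d n : nat) : 0 < d -> d * n <= N ->
  count (fun m => ~~ A (d * m)) (iota 1 n) <=
  count (fun x => ~~ A x && (d %| x)) (iota 1 N).
Proof.
move=> d0 h; rewrite -(count_map (muln d) (fun x => ~~ A x)) -!size_filter.
apply: uniq_leq_size.
  rewrite filter_uniq // map_inj_uniq ?iota_uniq // => x y /eqP.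
  by rewrite eqn_pmul2l // => /eqP.
move=> x; rewrite !mem_filter => /andP[-> /mapP[m hm ->]].
by rewrite dvdn_mulr //=; move: hm; rewrite !mem_iota; nia.
Qed.

(** Contrapositive of the swap. At most [2 * K] of the m <= N/q have both qm and um in [A]; every
    other m puts one of them in the complement, and u <= q keeps um <= N. *)
Lemma count_swap_le A (K N q u L : nat) : 0 < u <= q ->
  balanced A K u L -> ~ balanced A K q (L + 2) ->
  N %/ q <= 2 * K + count (fun x => ~~ A x && (q %| x)) (iota 1 N)
                  + count (fun x => ~~ A x && (u %| x)) (iota 1 N).
Proof.
case/andP=> u0 uq hu hq; have q0 : 0 < q by lia.
have hqN : q * (N %/ q) <= N by rewrite mulnC leq_divM.
have huN : u * (N %/ q) <= N by apply: leq_trans hqN; rewrite leq_mul2r uq orbT.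
have := count_avoiding_multiples A q0 hqN; have := count_avoiding_multiples A u0 huN.
have h : count (fun m => A (q * m) && A (u * m)) (iota 1 (N %/ q)) <= 2 * K.
  rewrite leqNgt; apply/negP => h; apply: hq; exact: balanced_swap h hu.
have : N %/ q <= count (fun m => A (q * m) && A (u * m)) (iota 1 (N %/ q))
   + count (fun m => ~~ A (q * m)) (iota 1 (N %/ q))
   + count (fun m => ~~ A (u * m)) (iota 1 (N %/ q)).
  rewrite -{1}(size_iota 1 (N %/ q)); elim: (iota 1 _) => //= x s IH.
  by case: (A (q * x)); case: (A (u * x)); rewrite /=; lia.
lia.
Qed.

(** The swap with u = 1: if it failed, N/p would be at most [2 * K] plus twice the size of the
    complement. *)
Lemma balanced_small A (K N p w : nat) : 0 < p <= w ->
  w * (2 * count (fun x => ~~ A x) (iota 1 N) + 2 * K + 1) <= N ->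
  balanced A K p 2.
Proof.
case/andP=> p0 pw h; apply: contrapT => hn.
have := @count_swap_le A K N p 1 0; rewrite p0 /= add0n => hc.
have {}hc := hc isT (@balanced1 A K) hn.
have hle (d : nat) : count (fun x => ~~ A x && (d %| x)) (iota 1 N) <=
    count (fun x => ~~ A x) (iota 1 N) by apply: sub_count => x /andP[].
have := hle p; have := hle 1.
have : (2 * count (fun x => ~~ A x) (iota 1 N) + 2 * K + 1) <= N %/ p.
  by rewrite leq_divRL //; apply: leq_trans h; rewrite mulnC leq_mul2r pw orbT.
lia.
Qed.

(** Forbidding [a] itself makes [a :: t] free of repetitions. It has the same product as [s] and one
    more element. *)
Lemma admissible_not_balanced (A : {fset nat}) K a L :
  admissible [set` A]%classic -> a \in A -> L < K ->
  ~ balanced (fun x => x \in A) K a L.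
Proof.
move=> [_ hA] aA LK /(_ [:: a]); rewrite /= add1n => /(_ LK).
move=> [s [t [us ut /allP hst [e _] pe]]].
have hx x : x \in s ++ t -> x \in A /\ x != a.
  by move/hst; rewrite inE => /andP.
have nat_ : a \notin t.
  by apply/negP => h; have [|_] := hx a; rewrite ?mem_cat ?h ?orbT ?eqxx.
have big_fset (r : seq nat) : uniq r -> \prod_(x <- [fset x in r]%fset) x = \prod_(x <- r) x.
  move=> ur; apply: perm_big; rewrite uniq_perm ?fset_uniq // => x.
  by rewrite !inE.
have card_fset (r : seq nat) : uniq r -> #|` [fset x in r]%fset| = size r.
  by move=> ur; rewrite card_fseq undup_id.
have := hA [fset x in s]%fset [fset x in (a :: t)]%fset.
rewrite !card_fset ?big_fset /= ?nat_ ?ut //.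
move=> /(_ _ _ _)/wrap[].
- by move=> x /=; rewrite !inE => h; have [|] := hx x; rewrite ?mem_cat ?h.
- move=> x /=; rewrite !inE => /orP[/eqP -> //|h].
  by have [|] := hx x; rewrite ?mem_cat ?h ?orbT.
- by rewrite big_cons pe.
by rewrite e => /eqP; lia.
Qed.

Local Open Scope classical_set_scope.

Local Open Scope ring_scope.

(** * Second moments of divisor counts *)

Section Sums.
Variable R : realFieldType.

Lemma sum_blk (X M : nat) (P Q : pred nat) (F : nat -> R) :
  (forall p, P p -> Q (blk p) -> (blk p < M.+1)%N) ->
  \sum_(p < X | P p && Q (blk p)) F p =
  \sum_(i < M.+1 | Q i) \sum_(p < X | P p && (blk p == i)) F p.
Proof.
move=> hM.
rewrite (partition_big (fun p : 'I_X => inord (blk p) : 'I_M.+1) (fun i => Q i)).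
  apply: eq_bigr => i Qi; apply: eq_bigl => p.
  case Pp: (P p) => //=; apply/andP/eqP => [[Qp /eqP <-]|e].
    by rewrite inordK // hM.
  by rewrite e; split=> //; apply/eqP/val_inj; rewrite /= inordK.
by move=> p /andP[Pp Qp]; rewrite inordK // hM.
Qed.

Lemma card_ord_count (X : nat) (P : pred nat) :
  #|[pred p : 'I_X | P p]| = count P (iota 0 X).
Proof. by rewrite -sum1_card -(big_mkord P (fun=> 1%N)) sum1_count /index_iota subn0. Qed.

Lemma block_recip_le (X i : nat) : (0 < i)%N ->
  \sum_(p < X | prime p && (blk p == i)) (p%:R : R)^-1 <= 8 / i%:R.
Proof.
move=> i0; have q0 : 0 < (16 ^ i)%:R :> R by rewrite ltr0n expn_gt0.
apply: (@le_trans _ _ (\sum_(p < X | prime p && (blk p == i)) (16 ^ i)%:R^-1)).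
  apply: ler_sum => p /andP[pp /eqP <-].
  have p0 := prime_gt0 pp.
  rewrite lef_pV2 ?posrE ?ltr0n ?expn_gt0 //.
  by rewrite ler_nat blk_ge.
rewrite sumr_const (card_ord_count X (fun p => prime p && (blk p == i))).
rewrite -[X in X <= _]mulr_natl ler_pdivlMr ?ltr0n // mulrAC ler_pdivrMr // -!natrM ler_nat mulnC.
exact: prime_block_le.
Qed.

Lemma blocks_recip_le (X M : nat) (Q : pred nat) :
  (forall i, Q i -> (0 < i < M.+1)%N) ->
  \sum_(p < X | prime p && Q (blk p)) (p%:R : R)^-1 <= \sum_(i < M.+1 | Q i) 8 / i%:R.
Proof.
move=> hQ; rewrite (@sum_blk _ M prime Q (fun p => p%:R^-1)); last first.
  by move=> p _ /hQ /andP[].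
by apply: ler_sum => i /hQ /andP[i0 _]; exact: block_recip_le.
Qed.

(** Cauchy-Schwarz against the constant 1, from the nonnegativity of the sum of (f i - c)^2 at the
    mean c = x / b. *)
Lemma sqr_sum_le (I : eqType) (s : seq I) (P : pred I) (f : I -> R) :
  (\sum_(i <- s | P i) f i) ^+ 2 <=
  (\sum_(i <- s | P i) 1) * \sum_(i <- s | P i) f i ^+ 2.
Proof.
set b := \sum_(i <- s | P i) 1; set x := \sum_(_ <- _ | _) f _.
set y := \sum_(_ <- _ | _) _ ^+ _.
have b0 : 0 <= b by apply: sumr_ge0.
have [bE|bN] := eqVneq b 0.
  suff -> : x = 0 by rewrite bE expr0n mul0r.
  rewrite /x big1_seq // => i /andP[Pi si].
  have := bE; rewrite /b => /eqP; rewrite big_seq_cond psumr_eq0 //.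
  by move/allP/(_ _ si); rewrite Pi si oner_eq0.
have bp : 0 < b by rewrite lt_def bN.
have h c : 0 <= y - 2 * c * x + c ^+ 2 * b.
  have -> : y - 2 * c * x + c ^+ 2 * b = \sum_(i <- s | P i) (f i - c) ^+ 2.
    rewrite /y /x /b !mulr_sumr -sumrB -big_split /=.
    by apply: eq_bigr => i _; ring.
  by apply: sumr_ge0 => i _; exact: sqr_ge0.
have := h (x / b).
have -> : y - 2 * (x / b) * x + (x / b) ^+ 2 * b = (b * y - x ^+ 2) / b by field.
by rewrite pmulr_lge0 ?invr_gt0 // subr_ge0.
Qed.

Lemma sum_multiples_le (N D : nat) : (0 < D)%N ->
  \sum_(1 <= n < N.+1 | (D %| n)%N) (1 : R) <= N%:R / D%:R.
Proof.
move=> D0; have -> : \sum_(1 <= n < N.+1 | (D %| n)%N) (1 : R) = (N %/ D)%:R.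
  by rewrite divn_count_dvd natr_sum big_mkcond; apply: eq_bigr => n _; case: (D %| n)%N.
by rewrite ler_pdivlMr ?ltr0n // -natrM ler_nat leq_divM.
Qed.

(** Let r(n) be the number of [x] in [V] with [d x] dividing n. The sum of r over [B] is at least
    delta * N * S, while the sum of r^2 over all n <= N is at most N * (S^2 + C * S). Cauchy-Schwarz
    on [B] then bounds the size of [B] from below. *)
Lemma large_sieve_divisors (I : finType) (V : pred I) (d : I -> nat) (N : nat)
    (B : pred nat) (delta C : R) :
  let S := \sum_(x | V x) (d x)%:R^-1 : R in
  (forall x, V x -> (0 < d x)%N) -> 0 <= delta -> 0 <= C ->
  (forall x, V x ->
    delta * (N%:R / (d x)%:R) <= \sum_(1 <= n < N.+1 | B n && (d x %| n)%N) 1) ->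
  \sum_(x | V x) \sum_(y | V y) (lcmn (d x) (d y))%:R^-1 <= S ^+ 2 + C * S ->
  delta ^+ 2 * S * N%:R <= (\sum_(1 <= n < N.+1 | B n) 1) * (S + C).
Proof.
move=> S d0 delta0 C0 hB hl; set b := \sum_(1 <= n < _ | _) _.
have b0 : 0 <= b by apply: sumr_ge0.
have S0 : 0 <= S by apply: sumr_ge0 => x _; rewrite invr_ge0.
have [->|N0] := posnP N; first by rewrite mulr0 mulr_ge0 ?addr_ge0.
pose r n : R := \sum_(x | V x) (d x %| n)%:R.
have hx : delta * N%:R * S <= \sum_(1 <= n < N.+1 | B n) r n.
  rewrite exchange_big /= mulr_sumr; apply: ler_sum => x Vx.
  rewrite -mulrA; apply: le_trans (hB x Vx) _.
  by rewrite big_mkcondr /=; apply: ler_sum => n _; case: ifP.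
have hy : \sum_(1 <= n < N.+1 | B n) r n ^+ 2 <= N%:R * (S ^+ 2 + C * S).
  apply: (@le_trans _ _ (\sum_(1 <= n < N.+1) r n ^+ 2)).
    rewrite big_mkcond; apply: ler_sum => n _; case: ifP => // _; exact: sqr_ge0.
  apply: le_trans (ler_wpM2l _ hl); last by rewrite ler0n.
  under eq_bigr => n _ do rewrite expr2 mulr_suml.
  rewrite exchange_big /= mulr_sumr; apply: ler_sum => x Vx.
  under eq_bigr => n _ do rewrite mulr_sumr.
  rewrite exchange_big /= mulr_sumr; apply: ler_sum => y Vy.
  apply: le_trans (sum_multiples_le N _); last by rewrite lcmn_gt0 !d0.
  rewrite [X in _ <= X]big_mkcond; apply: ler_sum => n _; rewrite dvdn_lcm.
  by case: (d x %| n)%N; case: (d y %| n)%N; rewrite /= ?mulr1 ?mulr0.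
have hc := sqr_sum_le (index_iota 1 N.+1) B r; rewrite -/b in hc.
have h1 : (delta * N%:R * S) ^+ 2 <= b * (N%:R * (S ^+ 2 + C * S)).
  apply: le_trans (ler_wpM2l b0 hy); apply: le_trans hc.
  by rewrite ler_sqr ?nnegrE // ?(le_trans _ hx) // !mulr_ge0.
have [->|Sn] := eqVneq S 0; first by rewrite mulr0 mul0r add0r mulr_ge0.
have Sp : 0 < S by rewrite lt_def Sn.
have Np : 0 < N%:R :> R by rewrite ltr0n.
rewrite -(ler_pM2r (mulr_gt0 Np Sp)).
have -> : delta ^+ 2 * S * N%:R * (N%:R * S) = (delta * N%:R * S) ^+ 2 by ring.
by have -> : b * (S + C) * (N%:R * S) = b * (N%:R * (S ^+ 2 + C * S)) by ring.
Qed.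

End Sums.

Section Pairs.
Variable R : realFieldType.

Lemma leq_blk m n : (m <= n)%N -> (blk m <= blk n)%N.
Proof. exact: leq_trunc_log. Qed.

Lemma ler_sum_pred (I : Type) (s : seq I) (P Q : pred I) (F : I -> R) :
  (forall i, P i -> Q i) -> (forall i, Q i -> 0 <= F i) ->
  \sum_(i <- s | P i) F i <= \sum_(i <- s | Q i) F i.
Proof.
move=> PQ F0; rewrite big_mkcond [X in _ <= X]big_mkcond.
by apply: ler_sum => i _; case: ifP => [/PQ -> //|_]; case: ifP => // /F0.
Qed.

Lemma recip_le_prod_primes (s : seq nat) m : (0 < m)%N -> uniq s -> all prime s ->
  all (fun p => p %| m)%N s -> m%:R^-1 <= (\prod_(p <- s) p)%:R^-1 :> R.
Proof.
move=> m0 us ps ds; have s0 : (0 < \prod_(p <- s) p)%N.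
  by rewrite big_seq prodn_cond_gt0 // => p /(allP ps)/prime_gt0.
rewrite lef_pV2 ?posrE ?ltr0n // ler_nat dvdn_leq //.
by apply: dvdn_prod_primes => // p /(allP ds).
Qed.

(** The lcm is at least the product of the distinct primes involved, and each coincidence removes
    one factor. The orderings exclude p1 = q2 together with p2 = q1, so two coincidences occur only
    when the pairs are equal. *)
Lemma recip_lcm_le (p1 p2 q1 q2 : nat) : prime p1 -> prime p2 -> prime q1 -> prime q2 ->
  (p1 < p2)%N -> (q1 < q2)%N ->
  (lcmn (p1 * p2) (q1 * q2))%:R^-1 <= p1%:R^-1 * p2%:R^-1 *
   (q1%:R^-1 * q2%:R^-1
    + (p1 == q1)%:R * q2%:R^-1 + (p1 == q2)%:R * q1%:R^-1
    + (p2 == q1)%:R * q2%:R^-1 + (p2 == q2)%:R * q1%:R^-1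
    + ((p1 == q1) && (p2 == q2))%:R) :> R.
Proof.
move=> pp1 pp2 pq1 pq2 lp lq.
have [p10 p20 q10 q20] : [/\ 0 < p1, 0 < p2, 0 < q1 & 0 < q2]%N by split; exact: prime_gt0.
set m := lcmn _ _.
have m0 : (0 < m)%N by rewrite lcmn_gt0 !muln_gt0 p10 p20 q10 q20.
have dp1 : (p1 %| m)%N by apply: dvdn_trans (dvdn_lcml _ _); rewrite dvdn_mulr.
have dp2 : (p2 %| m)%N by apply: dvdn_trans (dvdn_lcml _ _); rewrite dvdn_mull.
have dq1 : (q1 %| m)%N by apply: dvdn_trans (dvdn_lcmr _ _); rewrite dvdn_mulr.
have dq2 : (q2 %| m)%N by apply: dvdn_trans (dvdn_lcmr _ _); rewrite dvdn_mull.
have i0 (n : nat) : 0 <= n%:R^-1 :> R by rewrite invr_ge0.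
have b0 (b : bool) : 0 <= b%:R :> R by rewrite ler0n.
have key s (x : R) : uniq s -> all prime s -> all (fun p => p %| m)%N s ->
    (\prod_(p <- s) p)%:R^-1 <= x -> m%:R^-1 <= x.
  by move=> h1 h2 h3; apply: le_trans; exact: recip_le_prod_primes.
have np : (p1 == p2) = false by lia.
have [e1|n11] := eqVneq p1 q1.
  have [e2|n22] := eqVneq p2 q2.
    apply: (key [:: p1; p2]); rewrite /= ?inE ?np ?pp1 ?pp2 ?dp1 ?dp2 //.
    rewrite !big_cons big_nil muln1 natrM invfM.
    rewrite ler_peMr ?mulr_ge0 // lerDr !addr_ge0 // mulr_ge0 //.
  apply: (key [:: p1; p2; q2]); rewrite /= ?inE ?pp1 ?pp2 ?pq2 ?dp1 ?dp2 ?dq2 //; first by lia.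
  rewrite !big_cons big_nil muln1 !natrM !invfM mulrA ler_wpM2l ?mulr_ge0 //.
  rewrite mul1r addr0 -!addrA [X in _ <= X]addrCA lerDl !addr_ge0 // mulr_ge0 //.
have [e2|n22] := eqVneq p2 q2.
  apply: (key [:: p1; p2; q1]); rewrite /= ?inE ?pp1 ?pp2 ?pq1 ?dp1 ?dp2 ?dq1 //; first by lia.
  rewrite !big_cons big_nil muln1 !natrM !invfM mulrA ler_wpM2l ?mulr_ge0 //.
  rewrite mul1r addr0 lerDr !addr_ge0 // mulr_ge0 //.
have [e12|n12] := eqVneq p1 q2.
  apply: (key [:: p1; p2; q1]); rewrite /= ?inE ?pp1 ?pp2 ?pq1 ?dp1 ?dp2 ?dq1 //; first by lia.
  rewrite !big_cons big_nil muln1 !natrM !invfM mulrA ler_wpM2l ?mulr_ge0 //.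
  by rewrite !mul0r mul1r !addr0 -addrA addrCA lerDl !addr_ge0 // mulr_ge0.
have [e21|n21] := eqVneq p2 q1.
  apply: (key [:: p1; p2; q2]); rewrite /= ?inE ?pp1 ?pp2 ?pq2 ?dp1 ?dp2 ?dq2 //; first by lia.
  rewrite !big_cons big_nil muln1 !natrM !invfM mulrA ler_wpM2l ?mulr_ge0 //.
  by rewrite !mul0r mul1r !addr0 lerDr mulr_ge0.
apply: (key [:: p1; p2; q1; q2]);
  rewrite /= ?inE ?pp1 ?pp2 ?pq1 ?pq2 ?dp1 ?dp2 ?dq1 ?dq2 //; first by lia.
rewrite !big_cons big_nil muln1 !natrM !invfM mulrA ler_wpM2l ?mulr_ge0 //.
by rewrite !mul0r !addr0.
Qed.

(** A window of bounded ratio has bounded mass whatever its position: at most 3a + 1 blocks of mass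
    at most 8/a each. *)
Lemma blocks_above_le (X a : nat) :
  \sum_(q < X | prime q && (a < blk q <= 3 * a)%N) (q%:R : R)^-1 <= 32.
Proof.
apply: le_trans (@blocks_recip_le R X (3 * a) (fun k => a < k <= 3 * a)%N _) _.
  by move=> i; lia.
have [->|a0] := posnP a; first by rewrite big1 // => i; lia.
apply: (@le_trans _ _ (\sum_(i < (3 * a).+1 | (a < i <= 3 * a)%N) 8 / a%:R)).
  apply: ler_sum => i /andP[h _]; rewrite ler_wpM2l // lef_pV2 ?posrE ?ltr0n //; try lia.
  by rewrite ler_nat ltnW.
apply: (@le_trans _ _ (\sum_(i < (3 * a).+1) 8 / a%:R)).
  rewrite big_mkcond; apply: ler_sum => i _.
  by case: ifP; rewrite ?divr_ge0.
rewrite sumr_const card_ord -[X in X <= _]mulr_natl mulrA ler_pdivrMr ?ltr0n //.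
by rewrite -!natrM ler_nat; lia.
Qed.

Lemma blocks_below_le (X b : nat) :
  \sum_(p < X | prime p && (blk p < b <= 3 * blk p)%N) (p%:R : R)^-1 <= 32.
Proof.
have [->|b0] := posnP b.
  by rewrite big1 // => i /andP[_]; rewrite ltn0.
apply: le_trans (@blocks_recip_le R X b (fun k => k < b <= 3 * k)%N _) _.
  by move=> i; lia.
apply: (@le_trans _ _ (\sum_(i < b | (i < b <= 3 * i)%N) 24 / b%:R)).
  rewrite big_mkcond big_ord_recr /= ltnn addr0 -big_mkcond.
  apply: ler_sum => i /andP[h1 h2].
  have i0 : (0 < i)%N by lia.
  rewrite ler_pdivrMr ?ltr0n // mulrAC ler_pdivlMr ?ltr0n // -!natrM ler_nat; lia.
apply: (@le_trans _ _ (\sum_(i < b) 24 / b%:R)).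
  rewrite big_mkcond; apply: ler_sum => i _.
  by case: ifP; rewrite ?divr_ge0.
rewrite sumr_const card_ord -[X in X <= _]mulr_natl mulrA ler_pdivrMr ?ltr0n //.
by rewrite -!natrM ler_nat; lia.
Qed.

Lemma sum_eq_fst (X : nat) (V : rel nat) (F : nat -> R) (p : 'I_X) :
  \sum_(y : 'I_X * 'I_X | V y.1 y.2) (p == y.1 :> nat)%:R * F y.2 =
  \sum_(q < X | V p q) F q.
Proof.
rewrite -(pair_big_dep xpredT (fun i j : 'I_X => V i j)
  (fun i j : 'I_X => (p == i :> nat)%:R * F j)) /=.
rewrite (bigD1 p) //= [X in _ + X]big1 ?addr0 => [|i ne].
  by apply: eq_bigr => j _; rewrite eqxx mul1r.
by rewrite big1 // => j _; rewrite eq_sym (negbTE (ne : i != p :> nat)) mul0r.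
Qed.

Lemma sum_eq_snd (X : nat) (V : rel nat) (F : nat -> R) (p : 'I_X) :
  \sum_(y : 'I_X * 'I_X | V y.1 y.2) (p == y.2 :> nat)%:R * F y.1 =
  \sum_(q < X | V q p) F q.
Proof.
rewrite -(pair_big_dep xpredT (fun i j : 'I_X => V i j)
  (fun i j : 'I_X => (p == j :> nat)%:R * F i)) /= big_mkcond /=.
rewrite [RHS]big_mkcond; apply: eq_bigr => i _.
rewrite big_mkcond (bigD1 p) //= [X in _ + X]big1 ?addr0 => [|j ne].
  by rewrite eqxx mul1r.
by rewrite eq_sym (negbTE (ne : j != p :> nat)) mul0r if_same.
Qed.

(** For a fixed [x], the six terms of [recip_lcm_le] summed over [y] give S, four window sums of at
    most 32 each, and at most 1; 200 leaves room above 129. *)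
Lemma pairs_second_moment (X : nat) (V : rel nat) :
  (forall p q, V p q -> [/\ prime p, prime q & (blk p < blk q <= 3 * blk p)%N]) ->
  let S := \sum_(x : 'I_X * 'I_X | V x.1 x.2) (x.1 * x.2)%N%:R^-1 : R in
  \sum_(x : 'I_X * 'I_X | V x.1 x.2) \sum_(y : 'I_X * 'I_X | V y.1 y.2)
     (lcmn (x.1 * x.2) (y.1 * y.2))%:R^-1 <= S ^+ 2 + 200 * S.
Proof.
move=> hV; cbv zeta; set S := \sum_(x | _) (_ * _)%:R^-1.
rewrite expr2 -mulrDl -/S {2}/S mulr_sumr; apply: ler_sum => x Vx.
have [px1 px2 bx] := hV _ _ Vx.
have lt12 (p q : nat) : (blk p < blk q <= 3 * blk p)%N -> (p < q)%N.
  by case/andP => h _; rewrite ltnNge; apply: contraTN h => /leq_blk; rewrite -leqNgt.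
have i0 (n : nat) : 0 <= n%:R^-1 :> R by rewrite invr_ge0.
set E := fun y : 'I_X * 'I_X => (y.1 : nat)%:R^-1 * (y.2 : nat)%:R^-1
    + (x.1 == y.1 :> nat)%:R * (y.2 : nat)%:R^-1 + (x.1 == y.2 :> nat)%:R * (y.1 : nat)%:R^-1
    + (x.2 == y.1 :> nat)%:R * (y.2 : nat)%:R^-1 + (x.2 == y.2 :> nat)%:R * (y.1 : nat)%:R^-1
    + ((x.1 == y.1 :> nat) && (x.2 == y.2 :> nat))%:R : R.
apply: (@le_trans _ _ ((x.1 * x.2)%N%:R^-1 * \sum_(y : 'I_X * 'I_X | V y.1 y.2) E y)).
  rewrite mulr_sumr; apply: ler_sum => y Vy; have [py1 py2 by_] := hV _ _ Vy.
  by rewrite natrM invfM; apply: recip_lcm_le => //; apply: lt12.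
rewrite mulrC ler_wpM2r // /E !big_split /=.
have h0 : \sum_(y : 'I_X * 'I_X | V y.1 y.2) (y.1 : nat)%:R^-1 * (y.2 : nat)%:R^-1 = S.
  by apply: eq_bigr => y _; rewrite natrM invfM.
have ha (p : 'I_X) : \sum_(q < X | V p q) (q : nat)%:R^-1 <= 32 :> R.
  apply: le_trans (blocks_above_le X (blk p)).
  by apply: ler_sum_pred => // q /hV [_ -> ->].
have hb (p : 'I_X) : \sum_(q < X | V q p) (q : nat)%:R^-1 <= 32 :> R.
  apply: le_trans (blocks_below_le X (blk p)).
  by apply: ler_sum_pred => // q /hV [-> _ ->].
have h1 : \sum_(y : 'I_X * 'I_X | V y.1 y.2)
    ((x.1 == y.1 :> nat) && (x.2 == y.2 :> nat))%:R <= 1 :> R.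
  rewrite (bigD1 x) //= !eqxx /= big1 ?addr0 // => y /andP[_ ne].
  case: eqP => // e1; case: eqP => // e2; case/eqP: ne.
  by case: x y e1 e2 {Vx px1 px2 bx E} => [x1 x2] [y1 y2] /= /val_inj -> /val_inj ->.
rewrite h0 !(sum_eq_fst V (fun n => n%:R^-1)) !(sum_eq_snd V (fun n => n%:R^-1)).
have := (ha x.1, hb x.1, ha x.2, hb x.2); move=> [[[a1 a2] a3] a4]; lra.
Qed.

End Pairs.

(** * Products of two primes *)

(* By Chebyshev a block contains at least [2 * 16 ^ i / i] primes, so a rich block is
   one where at least half of that guaranteed number satisfies [T]. *)
Definition rich (X : nat) (T : pred nat) (i : nat) : bool :=
  (16 ^ i <= i * count (fun p => prime p && T p && (blk p == i)) (iota 0 X))%N.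

Section Lower.
Variable R : realFieldType.

Lemma block_recip_ge (X i : nat) (P : pred nat) : (0 < i)%N ->
  (16 ^ i <= i * count (fun p => prime p && P p && (blk p == i)) (iota 0 X))%N ->
  1 / (16 * i)%:R <= \sum_(p < X | (prime p && P p) && (blk p == i)) (p%:R : R)^-1.
Proof.
move=> i0 h.
apply: (@le_trans _ _
    (\sum_(p < X | (prime p && P p) && (blk p == i)) ((16 ^ i.+1)%:R : R)^-1)).
  rewrite sumr_const (card_ord_count X (fun p => prime p && P p && (blk p == i))).
  rewrite -[X in _ <= X]mulr_natl ler_pdivlMr ?ltr0n ?expn_gt0 //.
  rewrite mulrAC ler_pdivrMr ?ltr0n ?muln_gt0 //.
  by rewrite mul1r -natrM ler_nat expnS; nia.
apply: ler_sum => p /andP[/andP[pp _] /eqP <-].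
have p0 := prime_gt0 pp.
by rewrite lef_pV2 ?posrE ?ltr0n ?expn_gt0 // ler_nat ltnW // blk_lt.
Qed.

(** By Chebyshev, a block i >= 3 that is not rich has at least 16^i / i primes outside [T], of mass
    at least 1/(16i) >= 1/(16j). A total of 1/256 allows at most j/16 such blocks. *)
Lemma count_poor_le (X j : nat) (T : pred nat) : (16 ^ j <= X)%N ->
  \sum_(p < X | prime p && ~~ T p && (blk p < j)%N) (p%:R : R)^-1 <= 1 / 256 ->
  (16 * count (fun i => (3 <= i)%N && ~~ rich X T i) (iota 0 j) <= j)%N.
Proof.
case: j => [//|j] hX hE; set ng := fun i => _.
rewrite (@sum_blk R X j (fun p => prime p && ~~ T p) (fun i => i < j.+1)%N
  (fun p => p%:R^-1)) in hE; last by [].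
have h : \sum_(i < j.+1 | ng i) 1 / (16 * j.+1)%:R <= 1 / 256 :> R.
  apply: le_trans hE.
  apply: (@le_trans _ _ (\sum_(i < j.+1 | ng i)
     \sum_(p < X | (prime p && ~~ T p) && (blk p == i)) (p%:R : R)^-1)); last first.
    apply: ler_sum_pred => [i _|i _]; first exact: ltn_ord.
    by apply: sumr_ge0 => p _; rewrite invr_ge0.
  apply: ler_sum => i /andP[i3 hr].
  apply: le_trans (@block_recip_ge X i (fun p => ~~ T p) _ _); last 2 first.
  - by lia.
  - have hi : (16 ^ i.+1 <= X)%N.
      by apply: leq_trans hX; rewrite leq_exp2l // ltn_ord.
    have := prime_block_ge i3 hi; move: hr; rewrite /rich -ltnNge.
    set a := count _ _; set b := count _ _; set c := count _ _ => h1 h2.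
    have e : b = (a + c)%N.
      rewrite /a /b /c; elim: (iota 0 X) => //= p s ->.
      by case: (prime p); case: (T p); case: (blk p == i); rewrite /=; lia.
    by move: h2; rewrite e mulnDr; lia.
  rewrite !mul1r lef_pV2 ?posrE ?ltr0n ?muln_gt0 //; last by lia.
  by rewrite ler_nat; have := ltn_ord i; lia.
move: h; rewrite sumr_const (card_ord_count j.+1 ng) -[X in X <= _]mulr_natl.
rewrite mul1r ler_pdivrMr ?ltr0n ?muln_gt0 // mulrAC ler_pdivlMr ?ltr0n //.
by rewrite mul1r -!natrM ler_nat; lia.
Qed.

(** About j/4 indices [i] satisfy the window condition. Poor blocks spoil at most j/16 of them
    through [i] and j/16 through [j - 2 - i]. *)
Lemma count_rich_pairs (X M j : nat) (T : pred nat) :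
  (200 <= j <= M)%N ->
  (16 * count (fun i => (3 <= i)%N && ~~ rich X T i) (iota 0 j) <= j)%N ->
  (j <= 16 * count (fun i => [&& rich X T i, rich X T (j - 2 - i)
                            & (i < j - 2 - i <= 3 * i)%N]) (iota 0 M.+1))%N.
Proof.
move=> hj; set ng := fun i => (3 <= i)%N && _; set g := fun i => [&& _, _ & _] => hng.
(* These are (j-2)/4 and (j-2)/2 rounded up, so [L] lists exactly the solutions of
   [i < j - 2 - i <= 3 * i]. *)
pose a := ((j + 1) %/ 4)%N; pose b := ((j - 1) %/ 2)%N.
pose L := iota a (b - a).
have hL i : i \in L -> (a <= i < b)%N by rewrite mem_iota; lia.
have uL : uniq L by exact: iota_uniq.
have h0 : (size L <= count g L + count ng L + count (fun i => ng (j - 2 - i)) L)%N.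
  have : all (fun i => g i || ng i || ng (j - 2 - i)%N) L.
    apply/allP => i /hL hi; rewrite /g /ng.
    case: (rich X T i) => /=; last by apply/orP; left; rewrite /a in hi; lia.
    case: (rich X T _) => /=; last by rewrite /a /b in hi *; lia.
    by rewrite /a /b in hi *; lia.
  rewrite all_count => /eqP <-; elim: L {hL uL} => //= x s IH.
  by case: (g x); case: (ng x); case: (ng (j - 2 - x)%N); rewrite /=; lia.
have h1 : (count ng L <= count ng (iota 0 j))%N.
  rewrite -!size_filter; apply: uniq_leq_size; first by rewrite filter_uniq.
  move=> i; rewrite !mem_filter => /andP[-> /hL hi]; rewrite mem_iota /=.
  by rewrite /b in hi; lia.
have h2 : (count (fun i => ng (j - 2 - i)) L <= count ng (iota 0 j))%N.
  rewrite -(count_map (fun i => j - 2 - i)%N) -!size_filter; apply: uniq_leq_size.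
    apply: filter_uniq; rewrite map_inj_in_uniq // => x y /hL hx /hL hy.
    by rewrite /b in hx hy; lia.
  move=> i; rewrite !mem_filter => /andP[-> /mapP[x /hL hx ->]].
  by rewrite mem_iota /=; lia.
have h3 : (count g L <= count g (iota 0 M.+1))%N.
  rewrite -!size_filter; apply: uniq_leq_size; first by rewrite filter_uniq.
  move=> i; rewrite !mem_filter => /andP[-> /hL hi]; rewrite mem_iota /=.
  by rewrite /b in hi; lia.
have : (j <= 4 * size L + 8)%N by rewrite size_iota /a /b; lia.
by lia.
Qed.

Lemma sum_shift_le (M c : nat) (P D : pred nat) (F G : nat -> R) :
  (forall j, D j -> (c <= j)%N) ->
  (forall k, D (k + c)%N -> P k /\ G (k + c)%N <= F k) ->
  (forall k, P k -> 0 <= F k) ->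
  \sum_(j < M | D j) G j <= \sum_(k < M | P k) F k.
Proof.
move=> hc hD F0; rewrite -!(big_mkord _ (fun i => _ i)).
have s0 : 0 <= \sum_(0 <= k < M | P k) F k by apply: sumr_ge0.
case: (leqP c M) => hM; last first.
  rewrite big_nat_cond big1 // => j /andP[/andP[_ jM] /hc]; lia.
rewrite (@big_cat_nat _ _ _ c) //= [X in X + _]big_nat_cond big1 ?add0r; last first.
  by move=> j /andP[/andP[_ jM] /hc]; lia.
rewrite -{1}[c]add0n big_addn.
apply: (@le_trans _ _ (\sum_(0 <= k < M - c | P k) F k)).
  rewrite big_mkcond [X in _ <= X]big_mkcond; apply: ler_sum => k _.
  case: ifP => [/hD [-> //]|_]; case: ifP => // /F0 //.
rewrite [X in _ <= X](@big_cat_nat _ _ _ (M - c)) //= ?leq_subr //.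
by rewrite lerDl sumr_ge0.
Qed.

(* The product of such a pair lies in [16^(j-2), 16^j), where [j] in [J] is the block of
   the prime it is swapped with. *)
Definition swap_rel (T J : pred nat) : rel nat := fun p q =>
  [&& prime p && T p, prime q && T q, (blk p < blk q <= 3 * blk p)%N
    & J (blk p + blk q + 2)%N].

(** Each [j] in [J] has at least j/16 splittings j = i + k + 2 into rich blocks, and each of these
    carries mass at least 1/(16i) * 1/(16k) >= 1/(256j^2). Together they give 1/(4096j). *)
Lemma swap_pairs_recip_ge (X M : nat) (T J : pred nat) :
  (16 ^ M <= X)%N ->
  (forall j, J j -> (200 <= j <= M)%N) ->
  \sum_(p < X | prime p && ~~ T p && (blk p < M)%N) (p%:R : R)^-1 <= 1 / 256 ->
  \sum_(j < M.+1 | J j) 1 / (4096 * j)%:R <=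
  \sum_(x : 'I_X * 'I_X | swap_rel T J x.1 x.2) ((x.1 * x.2)%N%:R : R)^-1.
Proof.
move=> hX hJ hE.
pose g i := rich X T i.
pose Q a k := (a < k <= 3 * a)%N && J (a + k + 2)%N.
pose H a : R := \sum_(k < M.+1 | Q a k && g k) 1 / (16 * k)%:R.
have H0 a : 0 <= H a by apply: sumr_ge0 => k _; rewrite divr_ge0.
have hS : \sum_(p < X | prime p && T p) (p%:R : R)^-1 * H (blk p) <=
    \sum_(x : 'I_X * 'I_X | swap_rel T J x.1 x.2) ((x.1 * x.2)%N%:R : R)^-1.
  rewrite -(pair_big_dep (fun p : 'I_X => prime p && T p)
    (fun p q : 'I_X => (prime q && T q) && Q (blk p) (blk q))
    (fun p q : 'I_X => ((p * q)%N%:R)^-1)) /=; last first.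
  apply: ler_sum => p Pp; under [X in _ <= X]eq_bigr => q _ do rewrite natrM invfM.
  rewrite -mulr_sumr ler_wpM2l ?invr_ge0 //.
  rewrite (@sum_blk R X M (fun q => prime q && T q) (Q (blk p)) (fun q => q%:R^-1)).
    rewrite /H big_mkcondr /=; apply: ler_sum => k /andP[hk _]; case: ifP => hg.
      by apply: block_recip_ge => //; lia.
    by apply: sumr_ge0 => q _; rewrite invr_ge0.
  by move=> q _ /andP[_ /hJ]; lia.
apply: le_trans hS.
have h1 : \sum_(i < M.+1 | (0 < i)%N && g i) 1 / (16 * i)%:R * H i <=
    \sum_(p < X | prime p && T p) (p%:R : R)^-1 * H (blk p).
  apply: (@le_trans _ _ (\sum_(p < X | (prime p && T p) && (blk p < M.+1)%N)
      (p%:R : R)^-1 * H (blk p))); last first.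
    apply: ler_sum_pred => [p /andP[] //|p _].
    by rewrite mulr_ge0 ?invr_ge0.
  rewrite (@sum_blk R X M (fun p => prime p && T p) (fun i => i < M.+1)%N
    (fun p => p%:R^-1 * H (blk p))) //.
  apply: (@le_trans _ _ (\sum_(i < M.+1 | (0 < i)%N && g i)
    \sum_(p < X | prime p && T p && (blk p == i)) (p%:R : R)^-1 * H (blk p))).
    apply: ler_sum => i /andP[i0 gi].
    under [X in _ <= X]eq_bigr => p /andP[_ /eqP ->] do rewrite //.
    by rewrite -mulr_suml ler_wpM2r // block_recip_ge.
  apply: ler_sum_pred => [i _|i _]; first exact: ltn_ord.
  by apply: sumr_ge0 => p _; rewrite mulr_ge0 ?invr_ge0.
apply: le_trans h1.
pose D i j := [&& g i, g (j - 2 - i)%N & (i < j - 2 - i <= 3 * i)%N].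
apply: (@le_trans _ _ (\sum_(i < M.+1 | (0 < i)%N && g i)
   \sum_(j < M.+1 | J j && D i j) 1 / (256 * j ^ 2)%:R)); last first.
  apply: ler_sum => i /andP[i0 gi]; rewrite /H mulr_sumr.
  apply: (@sum_shift_le _ (i + 2) (fun k => Q i k && g k) (fun j => J j && D i j)
    (fun k => 1 / (16 * i)%:R * (1 / (16 * k)%:R)) (fun j => 1 / (256 * j ^ 2)%:R)).
  - by move=> j /andP[_ /and3P[_ _]]; lia.
  - move=> k; rewrite /D /Q (_ : k + (i + 2) - 2 - i = k)%N; last by lia.
    rewrite (_ : k + (i + 2) = i + k + 2)%N; last by lia.
    move=> /and4P[-> _ -> hk]; rewrite hk; split=> //.
    rewrite !mul1r -invfM -natrM lef_pV2 ?posrE ?ltr0n ?muln_gt0 //; try lia.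
    by rewrite ler_nat; nia.
  - by move=> k _; rewrite mulr_ge0 ?divr_ge0.
rewrite (exchange_big_dep (fun j : 'I_M.+1 => J j)) /=; last by move=> i j _ /andP[].
apply: ler_sum => j Jj; have hj := hJ _ Jj.
have hE' : \sum_(p < X | prime p && ~~ T p && (blk p < j)%N) (p%:R : R)^-1 <= 1 / 256.
  by apply: le_trans hE; apply: ler_sum_pred => p; [case/andP => -> h; lia|rewrite invr_ge0].
have hXj : (16 ^ j <= X)%N by apply: leq_trans hX; rewrite leq_exp2l //; lia.
have := count_rich_pairs hj (count_poor_le hXj hE').
rewrite -/(count (fun i => D i j) _) => hc.
apply: (@le_trans _ _ (\sum_(i < M.+1 | D i j) 1 / (256 * j ^ 2)%:R)).
  rewrite sumr_const (card_ord_count M.+1 (fun i => D i j)).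
  rewrite -[X in _ <= X]mulr_natl !mul1r ler_pdivlMr ?ltr0n ?muln_gt0 ?expn_gt0 //; last by lia.
  rewrite mulrC ler_pdivrMr ?ltr0n ?muln_gt0 //; last by lia.
  rewrite -natrM ler_nat -mulnn;
  move: (count _ _) hc => c hc; by nia.
apply: ler_sum_pred => [i|i _]; last by rewrite mul1r invr_ge0 ler0n.
rewrite Jj /D => /and3P[-> -> h]; rewrite h !andbT; lia.
Qed.

End Lower.

(** * Mass of the primes that are not balanced *)

(* The length [2 * blk p + 2] is additive along swaps: a prime in block [j] is swapped with
   a product of primes in blocks [i] and [j - 2 - i], and
   [(2 * i + 2) + (2 * (j - 2 - i) + 2) + 2 = 2 * j + 2]. *)
Definition reachable (A : pred nat) (K : nat) : pred nat :=
  fun p => `[< balanced A K p (2 * blk p + 2)%N >].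

(** The offset 2 absorbs the widths of the two blocks, which gives the inequality u <= q required
    for a swap; the ratio 16^3 keeps N/u comparable to N/q. *)
Lemma blk_mul_bounds p1 p2 q : (0 < p1)%N -> (0 < p2)%N -> (0 < q)%N ->
  blk q = (blk p1 + blk p2 + 2)%N ->
  (p1 * p2 <= q)%N /\ (q <= 16 ^ 3 * (p1 * p2))%N.
Proof.
move=> p10 p20 q0 e; split.
  apply: leq_trans (blk_ge q0); rewrite e addn2 -addSn -addnS expnD.
  by rewrite leq_mul // ltnW // blk_lt.
apply: leq_trans (ltnW (blk_lt q)) _; rewrite e -addnS addnC !expnD.
by rewrite !leq_mul // blk_ge.
Qed.

Section Step.
Variable R : realFieldType.

Lemma swap_mass_bound (S : R) : 1 / 512 <= 8 * 16 ^+ 3 * S ->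
  S + 200 < (1 / (4 * 16 ^+ 3)) ^+ 2 * S * 16 ^+ 18.
Proof.
move=> h; set w : R := 16 ^+ 3.
have w0 : w != 0 by rewrite expf_neq0 ?pnatr_eq0.
have -> : (1 / (4 * w)) ^+ 2 * S * 16 ^+ 18 = S * w * w ^+ 3 / 16.
  by rewrite (exprM _ 3 6) -/w; field.
have w1 : 300 <= w by rewrite /w; lra.
have y0 : 1 / 4096 <= S * w by rewrite /w; lra.
have S0 : 0 <= S by lra.
have h1 : S * 1 <= S * w by rewrite ler_wpM2l //; lra.
have h2 : 300 ^+ 3 <= w ^+ 3 by rewrite lerXn2r ?nnegrE; lra.
have h3 : S * w * 300 ^+ 3 <= S * w * w ^+ 3 by rewrite ler_wpM2l //; lra.
move: (S * w) (w ^+ 3) y0 h1 h3 => y z y0 h1; move: (y * z) => yz h3.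
rewrite mulr1 in h1; lra.
Qed.

Lemma sum1_countR (N : nat) (P : pred nat) :
  \sum_(1 <= n < N.+1 | P n) (1 : R) = (count P (iota 1 N))%:R.
Proof.
rewrite big_const_seq /index_iota subn1 /=.
by elim: (count _ _) => //= n ->; rewrite -natr1 addrC.
Qed.

(** Distinct primes have lcm pq, so only the diagonal exceeds the square of the mass, by at most the
    mass itself. *)
Lemma primes_second_moment (X : nat) (V : pred nat) :
  (forall p, V p -> prime p) ->
  \sum_(p < X | V p) \sum_(q < X | V q) (lcmn p q)%:R^-1 <=
  (\sum_(p < X | V p) (p%:R : R)^-1) ^+ 2 + 1 * \sum_(p < X | V p) (p%:R : R)^-1.
Proof.
move=> hV; rewrite mul1r expr2 mulr_suml -big_split /=; apply: ler_sum => p Vp.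
rewrite mulr_sumr (bigD1 p) //= [X in _ <= X + _](bigD1 p) //=.
rewrite (_ : lcmn p p = p); last by rewrite /lcmn gcdnn mulnK // prime_gt0 // hV.
rewrite [X in X <= _]addrC lerD // ler_wpDl ?mulr_ge0 ?invr_ge0 //.
apply: ler_sum => q /andP[Vq qp].
have c : coprime p q.
  by rewrite prime_coprime ?hV // dvdn_prime2 ?hV // eq_sym; exact: qp.
have -> : lcmn p q = (p * q)%N by rewrite -muln_lcm_gcd (eqP c) muln1.
by rewrite natrM invfM.
Qed.

Variables (A : pred nat) (K N M : nat).
Let T := reachable A K.
Let b : R := \sum_(1 <= n < N.+1 | ~~ A n) 1.
Let E j := \sum_(p < N.+1 | prime p && ~~ T p && (blk p < j)%N) (p%:R : R)^-1.

Hypothesis N0 : (0 < N)%N.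
Hypothesis hb : b * 16 ^+ 18 <= N%:R.
Hypothesis hK : ((4 * K + 2) * 16 ^ M <= N)%N.
Hypothesis Tsmall : forall p, prime p -> (blk p < 200)%N -> T p.

(** The sieve is used twice: on the [bad] primes, to show that they carry at most half of an
    excessive mass, and on products of two reachable primes, which the remaining primes force to
    have many multiples in the complement. *)
Lemma unreachable_mass_step j : (j < M)%N -> E j <= 1 / 256 -> E j.+1 <= 1 / 256.
Proof.
move=> jM hE; rewrite leNgt; apply/negP => hE1.
have b0 : 0 <= b by apply: sumr_ge0.
have Np : 0 < N%:R :> R by rewrite ltr0n.
pose cB d : R := \sum_(1 <= n < N.+1 | ~~ A n && (d %| n)%N) 1.
pose bad q := 1 / 4 * (N%:R / q%:R) <= cB q.
pose Q q := prime q && ~~ T q && (blk q < j.+1)%N.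
(* Both uses of the sieve end here: its conclusion together with [hb] yields delta^2 * S * 16^18 <=
   S + C after cancelling [b], and it is false outright when [b] is 0. *)
have contra (delta S C : R) : 0 < delta -> 0 < S ->
    delta ^+ 2 * S * N%:R <= b * (S + C) -> S + C < delta ^+ 2 * S * 16 ^+ 18 -> False.
  move=> d0 S0 h1 h2.
  have dS : 0 < delta ^+ 2 * S by rewrite mulr_gt0 ?exprn_gt0.
  have h3 := le_trans (ler_wpM2l (ltW dS) hb) h1.
  have [bE|bN] := eqVneq b 0.
    by move: h1; rewrite bE mul0r leNgt mulr_gt0.
  have bp : 0 < b by rewrite lt_def bN.
  by move: h3; rewrite mulrCA ler_pM2l // leNgt h2.
pose S0 : R := \sum_(q < N.+1 | Q q && bad q) q%:R^-1.
pose S1 : R := \sum_(q < N.+1 | Q q && ~~ bad q) q%:R^-1.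
have hS : E j.+1 = S0 + S1.
  by rewrite /E (bigID (fun q : 'I_N.+1 => bad q)).
have S0_le : S0 <= 1 / 512.
  rewrite leNgt; apply/negP => hS0.
  apply: (@contra (1 / 4) S0 1); [lra|lra| |lra].
  apply: (large_sieve_divisors (d := fun q : 'I_N.+1 => q : nat)).
  - by move=> q /andP[/andP[/andP[/prime_gt0]]].
  - by lra.
  - exact: ler01.
  - by move=> q /andP[].
  - by apply: (@primes_second_moment _ (fun q => Q q && bad q)) => q /andP[/andP[/andP[]]].
have S1_ge : 1 / 512 < S1 by lra.
(* Block [i] carries mass at most 8/i, so a mass above 1/512 of primes that are not bad makes the
   sum of 8/i over [J] at least 1/512. *)
pose J i := [exists q : 'I_N.+1, [&& Q q, ~~ bad q & blk q == i]].
have hJ i : J i -> (200 <= i <= j)%N.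
  case/existsP => q /and3P[/andP[/andP[pq Tq] bq] _ /eqP <-].
  by rewrite -(ltnS _ j) bq andbT leqNgt; apply/negP => h; case/negP: Tq; exact: Tsmall.
have hJs : 1 / 512 <= \sum_(i < j.+1 | J i) 8 / i%:R :> R.
  apply: le_trans (ltW S1_ge) _.
  have hJ0 i : J i -> (0 < i < j.+1)%N by move=> /hJ /andP[h1 h2]; rewrite ltnS h2 (leq_trans _ h1).
  apply: le_trans (blocks_recip_le R N.+1 hJ0).
  apply: ler_sum_pred => [q h|q _]; last by rewrite invr_ge0.
  case/andP: (h) => /andP[/andP[-> _] _] hb'.
  by apply/existsP; exists q; case/andP: h => -> -> /=.
have jN : (16 ^ j <= N.+1)%N.
  apply: (@leq_trans (16 ^ M)); first by rewrite leq_exp2l // ltnW.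
  by apply: leqW; apply: leq_trans hK; rewrite leq_pmull // addn_gt0 orbT.
have := swap_pairs_recip_ge jN hJ hE.
set S := (X in _ <= X) => hS2.
have S_ge : 1 / 512 <= 8 * 4096 * S.
  apply: le_trans hJs _; apply: le_trans (ler_wpM2l _ hS2); last by rewrite mulr_ge0 ?ler0n.
  rewrite mulr_sumr; apply: ler_sum => i _.
  by rewrite natrM invfM mul1r mulrA mulfK ?pnatr_eq0.
have e16 : 4096 = 16 ^+ 3 :> R by rewrite -natrX.
rewrite e16 in S_ge.
have S_gt0 : 0 < S.
  have h : 0 < 8 * 16 ^+ 3 :> R by rewrite mulr_gt0 // exprn_gt0.
  by rewrite -(pmulr_rgt0 _ h); apply: lt_le_trans S_ge; rewrite divr_gt0 ?ltr01 ?ltr0n.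
have d0 : 0 < 1 / (4 * 16 ^+ 3) :> R by rewrite divr_gt0 // mulr_gt0 // exprn_gt0.
apply: (contra _ _ _ d0 S_gt0 _ (swap_mass_bound S_ge)).
have hV p q : swap_rel T J p q -> [/\ prime p, prime q & (blk p < blk q <= 3 * blk p)%N].
  by case/and4P => /andP[-> _] /andP[-> _] -> _.
apply: (large_sieve_divisors (d := fun x : 'I_N.+1 * 'I_N.+1 => (x.1 * x.2)%N)).
- by move=> x /hV[/prime_gt0 ? /prime_gt0 ? _]; rewrite muln_gt0; apply/andP.
- exact: ltW.
- exact: ler0n.
- move=> [p1 p2] /and4P[/= /andP[pp1 /asboolP t1] /andP[pp2 /asboolP t2] hbl /existsP[q]].
  case/and3P => /andP[/andP[pq /negP Tq] bq] gq /eqP bqE.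
  have q0 := prime_gt0 pq.
  set u := (p1 * p2)%N.
  have u0 : (0 < u)%N by rewrite muln_gt0 !prime_gt0.
  have [uq qu] := blk_mul_bounds (prime_gt0 pp1) (prime_gt0 pp2) q0 bqE.
  have bu : balanced A K u (2 * blk q).
    have := balancedM t1 t2; apply: balancedW.
    by rewrite bqE -addnA addnCA !mulnDr; clear; lia.
  have bq' : ~ balanced A K q (2 * blk q + 2) by move=> h; apply: Tq; apply/asboolP.
  have u1 : (0 < u <= q)%N by rewrite u0.
  have := count_swap_le N u1 bu bq'; rewrite -(ler_nat R) 2!natrD.
  rewrite -!sum1_countR -/(cB q) -/(cB u) => hc.
  have hq : cB q < 1 / 4 * (N%:R / q%:R) by rewrite ltNge.
  have hf : N%:R / q%:R <= (N %/ q)%:R + 1 :> R.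
    by rewrite ler_pdivrMr ?ltr0n // natr1 -natrM ler_nat ltnW // ltn_ceil.
  have hk : (4 * K + 2)%:R <= N%:R / q%:R :> R.
    rewrite ler_pdivlMr ?ltr0n // -natrM ler_nat; apply: leq_trans hK.
    rewrite leq_mul2l; apply/orP; right; apply: leq_trans (ltnW (blk_lt q)) _.
    by rewrite leq_exp2l // (leq_trans bq).
  have hqu : N%:R / u%:R <= 16 ^+ 3 * (N%:R / q%:R) :> R.
    rewrite mulrCA ler_wpM2l // ler_pdivlMr ?ltr0n // mulrC ler_pdivrMr ?ltr0n //.
    by rewrite -natrX -natrM ler_nat.
  have hk' : 4 * K%:R + 2 <= N%:R / q%:R :> R by rewrite -natrM -natrD.
  have hc' : (N %/ q)%:R <= 2 * K%:R + cB q + cB u by rewrite -natrM.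
  (* Of N/q, at most half is lost to 2K and the rounding, and less than a quarter to multiples of
     [q], which is not bad. A quarter remains for [u], hence 1/(4 * 16^3) of N/u. *)
  have hx : 1 / 4 * (N%:R / q%:R) <= cB u by clear - hk' hc' hq hf; lra.
  apply: le_trans hx; rewrite !mul1r invfM -mulrA ler_wpM2l ?invr_ge0 //.
  by rewrite ler_pdivrMl ?exprn_gt0.
- exact: pairs_second_moment.
Qed.

Lemma unreachable_mass_le j : (j <= M)%N -> E j <= 1 / 256.
Proof.
elim: j => [|j IH] jM; first by rewrite /E big1 ?divr_ge0 ?ler01 ?ler0n // => p /andP[].
by apply: unreachable_mass_step => //; apply: IH; exact: ltnW.
Qed.

End Step.

(** * Conclusion *)

Section Cover.
Variable R : realFieldType.

(** A union bound over the sets of multiples of the elements of [V]. *)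
Lemma count_covered_le (N : nat) (A V : pred nat) :
  (forall p, V p -> (0 < p)%N) ->
  (forall a, (0 < a <= N)%N -> A a -> exists2 p, V p & (p %| a)%N) ->
  (count A (iota 1 N))%:R <= N%:R * \sum_(p < N.+1 | V p) (p%:R : R)^-1.
Proof.
move=> V0 hA; rewrite -sum1_countR.
apply: (@le_trans _ _ (\sum_(1 <= n < N.+1) \sum_(p < N.+1 | V p) (p %| n)%N%:R)).
  rewrite big_mkcond big_nat_cond [X in _ <= X]big_nat_cond; apply: ler_sum => n.
  rewrite andbT => hn; have [An|_] := ifP; last by apply: sumr_ge0.
  have [//|p Vp dp] := hA n _ An.
  have pN : (p < N.+1)%N by apply: leq_ltn_trans (dvdn_leq _ dp) _; case/andP: hn.
  rewrite (bigD1 (Ordinal pN)) //= dp lerDl.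
  by apply: sumr_ge0.
rewrite exchange_big /= mulr_sumr; apply: ler_sum => p Vp.
apply: le_trans (sum_multiples_le R N (V0 _ Vp)).
by rewrite [X in _ <= X]big_mkcond; apply: ler_sum => n _; case: ifP => // ->.
Qed.

(** At most M/32 blocks, of mass at most 8/M each. *)
Lemma top_blocks_le (X M Z : nat) : (0 < M)%N -> (32 * (Z.+1 - M) <= M)%N ->
  \sum_(p < X | prime p && (M <= blk p <= Z)%N) (p%:R : R)^-1 <= 1 / 4.
Proof.
move=> M0 hM.
apply: le_trans (@blocks_recip_le R X Z (fun i => M <= i <= Z)%N _) _; first by lia.
apply: (@le_trans _ _ (\sum_(i < Z.+1 | predT (i : nat) && (M <= i)%N) 8 / M%:R)).
  apply: (@le_trans _ _ (\sum_(i < Z.+1 | (M <= i <= Z)%N) 8 / M%:R)).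
    apply: ler_sum => i /andP[h _]; have i0 : (0 < i)%N by exact: leq_trans h.
    by rewrite ler_wpM2l // lef_pV2 ?posrE ?ltr0n // ler_nat.
  by apply: ler_sum_pred => [i /andP[]|i _] //; rewrite divr_ge0.
rewrite -(big_geq_mkord _ _ predT (fun=> 8 / M%:R)) sumr_const_nat.
rewrite -[X in X <= _]mulr_natl mulrA ler_pdivrMr ?ltr0n // mulrAC ler_pdivlMr //.
by rewrite mul1r -!natrM ler_nat; lia.
Qed.

End Cover.

Lemma linear_le_expn16 t Z : (250 <= t)%N -> (Z < 40 * t.+1)%N ->
  (4 * (8 * Z.+1 ^ 2) + 2 <= 16 ^ t)%N.
Proof.
move=> ht hZ; have h2 : (t < 2 ^ t)%N by exact: ltn_expl.
have -> : (16 ^ t = (2 ^ t * 2 ^ t) * (2 ^ t * 2 ^ t))%N by rewrite -!expnMn.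
move: (2 ^ t)%N h2 => y h2; rewrite -mulnn.
have h3 : (250 * 250 <= y * y)%N by rewrite leq_mul //; lia.
have h4 : (Z.+1 * Z.+1 <= 40 * y * (40 * y))%N by rewrite leq_mul //; lia.
nia.
Qed.

(** Every element of [A] has an unreachable prime factor. Such primes have mass at most 1/256 below
    block [M] and at most 1/4 above, whereas [A] fills at least half of [1, N]. *)
Lemma dense_not_admissible (A : {fset nat}) (N Z h : nat) : (250 <= h)%N ->
  (100 * 100 <= Z)%N -> (16 ^ Z <= N < 16 ^ Z.+1)%N ->
  (forall a, a \in A -> (1 <= a <= N)%N) ->
  (16 ^ h * count (fun x => x \notin A) (iota 1 N) <= N)%N ->
  ~ admissible [set` A].
Proof.
move=> h250 hZ /andP[NZ NZ1] hA hB adm.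
(* The top [t] blocks are set aside, so that 16^t can absorb the budget [K]; a fortieth of [Z] keeps
   their mass below 1/4, and Z >= 10000 gives t >= 250. *)
pose a x := x \in A; pose t := (Z %/ 40)%N; pose M := (Z - t)%N.
(* An element of [A] has fewer than 4(Z+1) prime factors, each with a representation of length at
   most 2Z + 2 if reachable; [K] exceeds the product of the two bounds. *)
pose K := (8 * Z.+1 ^ 2)%N.
have ht : (250 <= t)%N by rewrite /t; lia.
have hZt : (Z < 40 * t.+1)%N by rewrite /t; lia.
have tZ : (40 * t <= Z)%N by rewrite /t; lia.
have hK : ((4 * K + 2) * 16 ^ M <= N)%N.
  apply: leq_trans NZ; rewrite -(@subnKC t Z) -/M; last by lia.
  by rewrite expnD leq_mul // linear_le_expn16.
have N0 : (0 < N)%N by apply: leq_trans NZ; rewrite expn_gt0.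
have hM : (32 * (Z.+1 - M) <= M)%N by rewrite /M; lia.
have M200 : (200 <= M)%N by rewrite /M; lia.
set nb := count _ _ in hB.
have Tsmall p : prime p -> (blk p < 200)%N -> reachable a K p.
  move=> pp bp; apply/asboolP; apply: (@balancedW _ _ _ 2); first by rewrite leq_addl.
  have : (200 < h)%N by lia.
  move: M200 bp; move: 200%N => s sM bp sh; apply: (@balanced_small _ _ N _ (16 ^ s)).
    by rewrite prime_gt0 //= (leq_trans (ltnW (blk_lt p))) // leq_exp2l.
  rewrite -/nb.
  have h1 : (16 ^ s * (4 * K + 2) <= N)%N.
    by apply: leq_trans hK; rewrite mulnC leq_mul2l leq_exp2l // sM orbT.
  have h2 : (16 ^ s * (16 * nb) <= N)%N.
    by apply: leq_trans hB; rewrite mulnA -expnSr leq_mul2r leq_exp2l // sh orbT.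
  by move: (16 ^ s)%N h1 h2 => w h1 h2; nia.
have hb : (\sum_(1 <= n < N.+1 | ~~ a n) 1) * 16 ^+ 18 <= N%:R :> rat.
  have := leq_trans (isT : (18 <= 250)%N) h250; move: 18%N => e eh.
  rewrite sum1_countR -natrX -natrM ler_nat.
  by apply: leq_trans hB; rewrite mulnC leq_mul2r leq_exp2l // eh orbT.
have hE := unreachable_mass_le N0 hb hK Tsmall (leqnn M).
pose V p := prime p && ~~ reachable a K p.
have hV : \sum_(p < N.+1 | V p) (p%:R : rat)^-1 <= 1 / 256 + 1 / 4.
  rewrite (bigID (fun p : 'I_N.+1 => blk p < M)%N) /= lerD //.
  apply: le_trans (top_blocks_le rat N.+1 _ hM); last by lia.
  apply: ler_sum_pred => [p /andP[/andP[-> _]]|p _]; last by rewrite invr_ge0.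
  (* Primality of [p] has been discharged, so 0 is treated apart: its block is 0. *)
  rewrite -leqNgt => -> /=; have [->|p0] := posnP p; first by rewrite /blk trunc_log0.
  rewrite -ltnS -(@ltn_exp2l 16) //.
  by apply: leq_ltn_trans (blk_ge p0) _; apply: leq_ltn_trans NZ1; rewrite -ltnS.
have hcov x : (0 < x <= N)%N -> a x -> exists2 p, V p & (p %| x)%N.
  case/andP=> x0 xN ax; apply: contrapT => hn.
  have hlog : (trunc_log 2 x < 4 * Z.+1)%N.
    rewrite -(@ltn_exp2l 2) //; apply: leq_ltn_trans (trunc_logP _ x0) _ => //.
    by rewrite -expn16; exact: leq_ltn_trans NZ1.
  apply: (@admissible_not_balanced A K x ((2 * Z.+1) * trunc_log 2 x) adm ax).
    by rewrite /K -mulnn; nia.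
  apply: balanced_of_primes => // p pp dp.
  have pN : (p <= N)%N by apply: leq_trans xN; exact: dvdn_leq.
  have bp : (blk p <= Z)%N.
    rewrite -ltnS -(@ltn_exp2l 16) //; apply: leq_ltn_trans (blk_ge (prime_gt0 pp)) _.
    exact: leq_ltn_trans NZ1.
  apply: (@balancedW _ _ _ (2 * blk p + 2)); first by lia.
  apply: contrapT => hp; apply: hn; exists p => //.
  by rewrite /V pp; apply/asboolPn.
have := @count_covered_le rat N a V _ hcov.
move=> /(_ (fun p h => prime_gt0 (proj1 (andP h)))) hc.
have e : (count a (iota 1 N) + nb = N)%N by rewrite /nb /a count_predC size_iota.
have h2 : (2 * nb <= N)%N.
  by apply: leq_trans hB; rewrite leq_mul2r (leq_trans _ (ltn_expl h _)) ?orbT //; lia.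
have hc2 : 2 * (count a (iota 1 N))%:R < N%:R :> rat.
  have Np : 0 < N%:R :> rat by rewrite ltr0n.
  have := ler_wpM2l (ltW Np) hV; clear - hc Np; lra.
move: hc2; rewrite -natrM ltr_nat; lia.
Qed.

(** From e >= 2 one gets e^(4k) >= 16^k. *)
Lemma expR_ge_exp16 (R : realType) (k : nat) (x : R) :
  (4 * k)%:R <= x -> (16 ^ k)%:R <= expR x.
Proof.
move=> hx; apply: (@le_trans _ _ (expR (4 * k)%:R)); last by rewrite ler_expR.
have -> : (4 * k)%:R = (4 * k)%:R * 1 :> R by rewrite mulr1.
rewrite expRM_natl expn16 natrX lerXn2r ?nnegrE ?expR_ge0 //.
have := expR_ge1Dx (1 : R); lra.
Qed.

Lemma explicit_bound (R : realType) (N : nat) (A : {fset nat}) :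
  expR (2 * 10 ^+ 5) <= N%:R :> R ->
  (forall a : nat, a \in A -> (1 <= a <= N)%N) -> admissible [set` A] ->
  #|` A|%:R < (1 - expR (- (5 * 10 ^+ 3))) * N%:R :> R.
Proof.
move=> hN hA adm.
(* This holds with room to spare, since 4 * 10000 <= 200000. *)
have h0 : (16 ^ (100 * 100))%:R <= N%:R :> R.
  by apply: le_trans (expR_ge_exp16 _) hN; clear; rewrite !natrM; lra.
rewrite ler_nat in h0.
have N0 : (0 < N)%N by apply: leq_trans h0; rewrite expn_gt0.
have hZ : (100 * 100 <= blk N)%N by apply: trunc_log_max.
have hb : (16 ^ blk N <= N < 16 ^ (blk N).+1)%N by rewrite blk_ge // blk_lt.
pose a x := x \in A.
have e : (count a (iota 1 N) + count (fun x => x \notin A) (iota 1 N) = N)%N.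
  by rewrite count_predC size_iota.
have eA : #|` A| = count a (iota 1 N).
  rewrite -size_filter; apply: perm_size; apply: uniq_perm.
  - exact: fset_uniq.
  - by rewrite filter_uniq // iota_uniq.
  move=> x; rewrite mem_filter mem_iota /a; case: (boolP (x \in A)) => //= /hA.
  by rewrite add1n ltnS => ->.
move: e; rewrite -eA; set nb := count _ _ => e.
(* The complement will have density above 16^(-h), which is at least e^(-4h); h = 250 meets both
   constraints, as 1000 <= 5000. *)
have [h [h250 hx]] : exists h, (250 <= h)%N /\ (4 * h)%:R <= 5 * 10 ^+ 3 :> R.
  exists 250%N; split; first by [].
  have h3 : 250%:R <= 10 ^+ 3 :> R by rewrite -natrX ler_nat.
  by rewrite natrM; apply: ler_pM h3; rewrite ?ler0n ?ler_nat.
have hB : (N < 16 ^ h * nb)%N.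
  rewrite ltnNge; apply/negP => hB.
  exact: (dense_not_admissible h250 hZ hb hA hB adm).
have hE := expR_ge_exp16 hx.
have hr : N%:R < expR (5 * 10 ^+ 3) * nb%:R :> R.
  apply: (@lt_le_trans _ _ ((16 ^ h)%:R * nb%:R)); first by rewrite -natrM ltr_nat.
  by rewrite ler_wpM2r.
have hr' : expR (- (5 * 10 ^+ 3)) * N%:R < nb%:R :> R.
  by rewrite expRN mulrC ltr_pdivrMr ?expR_gt0 // mulrC.
have eR : N%:R = #|` A|%:R + nb%:R :> R by rewrite -natrD e.
by rewrite mulrBl mul1r ltrBrDr [X in _ < X]eR ltrD2l.
Qed.

Theorem theorem2 (R : realType) :
  (exists2 eta : R, 0 < eta &
    exists N0 : nat, forall N : nat, (N0 <= N)%N ->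
      forall A : {fset nat},
        (forall a : nat, a \in A -> (1 <= a <= N)%N) ->
        admissible [set` A] ->
        #|` A|%:R < (1 - eta) * N%:R) /\
  (forall N : nat, expR (2 * 10 ^+ 5) <= N%:R :> R ->
    forall A : {fset nat},
      (forall a : nat, a \in A -> (1 <= a <= N)%N) ->
      admissible [set` A] ->
      #|` A|%:R < (1 - expR (- (5 * 10 ^+ 3))) * N%:R :> R).
Proof.
split; last by move=> N hN A; exact: explicit_bound.
exists (expR (- (5 * 10 ^+ 3))); first exact: expR_gt0.
exists (Num.bound (expR (2 * 10 ^+ 5) : R)) => N hN A; apply: explicit_bound.
apply: le_trans (ltW (archi_boundP (expR_ge0 _))) _.
by rewrite ler_nat.
Qed.
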